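(* Let $\mathscr T=(V,E)$ be a directed tree with $\mathrm{card}(V)\leqslant\aleph_0$ and let $S_{\boldsymbol\lambda}\in\boldsymbol B(\ell^2(V))$ be a bounded weighted shift on $\mathscr T$ with weights $\boldsymbol\lambda=\{\lambda_v\}_{v\in V^\circ}\subseteq\mathbb C$. Then $S_{\boldsymbol\lambda}$ is centered if and only if for every $u_1,u_2\in V$ for which there is $n\in\mathbb Z_+$ such that $\mathsf{par}^{n+1}(u_1)$ and $\mathsf{par}^{n+1}(u_2)$ are defined, $\mathsf{par}^{n+1}(u_1)=\mathsf{par}^{n+1}(u_2)$ and $$\lambda_{u_1}\lambda_{\mathsf{par}(u_1)}\cdots\lambda_{\mathsf{par}^n(u_1)}\,\lambda_{u_2}\lambda_{\mathsf{par}(u_2)}\cdots\lambda_{\mathsf{par}^n(u_2)}\neq0,$$ the equality $$\sum_{y\in\mathsf{Chi}(u_1)}|\lambda_y|^2=\sum_{y\in\mathsf{Chi}(u_2)}|\lambda_y|^2$$ holds.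
   Context: $\mathbb Z_+=\{0,1,2,\dots\}$. A directed tree $\mathscr T=(V,E)$ is a directed graph that is connected (as an undirected graph), has no directed circuits, and in which every vertex has at most one parent. $\mathsf{Chi}(u)=\{v\in V:(u,v)\in E\}$ is the set of children of $u$; $\mathsf{par}$ is the partial function on $V$ assigning to a vertex $u$ its parent (the unique $v$ with $(v,u)\in E$), and $\mathsf{par}^n$ is its $n$-fold composition. A vertex without a parent is called a root; it is unique if it exists and is denoted $\mathsf{root}$. $V^\circ=V\setminus\{\mathsf{root}\}$ if there is a root, $V^\circ=V$ otherwise. Given weights $\boldsymbol\lambda=\{\lambda_v\}_{v\in V^\circ}\subseteq\mathbb C$ with $\sup_{v\in V}\sum_{u\in\mathsf{Chi}(v)}|\lambda_u|^2<\infty$, the weighted shift $S_{\boldsymbol\lambda}$ on $\mathscr T$ is the bounded operator on $\ell^2(V)$ given by $(S_{\boldsymbol\lambda}f)(v)=\lambda_v f(\mathsf{par}(v))$ for $v\in V^\circ$ and $(S_{\boldsymbol\lambda}f)(\mathsf{root})=0$. $\boldsymbol B(\mathcal H)$ denotes the bounded operators on $\mathcal H$. A bounded operator $T$ on a complex Hilbert space is centered if all the operators $T^{n}T^{*n}$, $T^{*n}T^{n}$, $n\geqslant1$, commute with each other. *)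

(* Defs.v *)
From HB Require Import structures.
From mathcomp Require Import all_boot all_order all_algebra complex.
From mathcomp Require Import all_classical all_reals ereal esum.
From mathcomp Require Import ring.

Set Implicit Arguments.
Unset Strict Implicit.
Unset Printing Implicit Defensive.
Import Order.TTheory GRing.Theory Num.Theory.
Import ComplexField.Normc.

Local Open Scope classical_set_scope.
Local Open Scope ring_scope.

(* [edge u v] means that (u, v) is an edge, i.e. that u is a parent of v. *)
Record directed_tree (V : choiceType) := DirectedTree {
  edge :> rel V;
  edge_connected : forall u v, exists2 p : seq V,
        path (fun x y => edge x y || edge y x) u p & last u p = v;
  edge_acyclic : forall c : seq V, c != [::] -> ~~ cycle edge c;
  edge_parent_uniq : forall u w v, edge u v -> edge w v -> u = w
}.

Section Tree.
Variables (V : choiceType) (T : directed_tree V).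

Definition Chi (u : V) : set V := [set v | T u v].

(* The root, if any, is the only vertex sent to [None]. *)
Definition par (v : V) : option V :=
  if pselect (exists u, T u v) is left h then Some (xchoose h) else None.

Definition parn (n : nat) (v : V) : option V := iter n (obind par) (Some v).

Lemma parP v u : par v = Some u <-> T u v.
Proof.
rewrite /par; case: pselect => [h|nh]; split => //.
- by move=> [<-]; exact: (xchooseP h).
- by move=> uv; rewrite (edge_parent_uniq (xchooseP h) uv).
- by move=> uv; case: nh; exists u.
Qed.

End Tree.

Section SumSq.
Variables (R : realType) (V : choiceType).
Implicit Types (A : set V) (f g : V -> R[i]).

Definition sumsq A f : \bar R := (\esum_(v in A) ((normc (f v)) ^+ 2)%:E)%E.

Definition sqsummable : {pred V -> R[i]} :=
  [pred f | `[< (sumsq setT f < +oo)%E >]].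

Lemma sqnormcD (x y : R[i]) :
  normc (x + y) ^+ 2 <= 2 * normc x ^+ 2 + 2 * normc y ^+ 2.
Proof.
case: x y => [a b] [c d] /=; rewrite !sqr_sqrtr ?addr_ge0 ?sqr_ge0//.
rewrite -subr_ge0 (_ : _ - _ = (a - c) ^+ 2 + (b - d) ^+ 2).
  by rewrite addr_ge0 ?sqr_ge0.
by rewrite !sqrrB !sqrrD !mulr_natl; ring.
Qed.

Lemma sumsq_ge0 A f : (0 <= sumsq A f)%E.
Proof. by apply: esum_ge0 => v _; rewrite lee_fin sqr_ge0. Qed.

Lemma esumZ_le A (k : R) (a : V -> R) : 0 <= k -> (forall v, 0 <= a v) ->
  (\esum_(v in A) (k * a v)%:E <= k%:E * \esum_(v in A) (a v)%:E)%E.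
Proof.
move=> k0 a0; apply: ge_ereal_sup => _ [F [finF FA] <-].
under eq_fsbigr do rewrite EFinM.
rewrite -ge0_mule_fsumr; last by move=> v; rewrite lee_fin.
apply: lee_wpmul2l; first by rewrite lee_fin.
by apply: ereal_sup_ubound; exists F.
Qed.

Lemma sqsummable_submod_closed : submod_closed sqsummable.
Proof.
split.
  apply/asboolP; rewrite /sumsq esum1 ?ltry// => v _.
  by rewrite [normc _](@normc0 R) expr0n.
move=> k f g /asboolP ff /asboolP gg; apply/asboolP.
have kf : (\esum_(v in setT) (2 * normc (k * f v) ^+ 2)%:E < +oo)%E.
  apply: (@le_lt_trans _ _
    ((2 * normc k ^+ 2)%:E * sumsq setT f)%E); last first.
    by rewrite lte_mul_pinfty// lee_fin mulr_ge0 ?sqr_ge0.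
  rewrite (eq_esum (b := fun v => (2 * normc k ^+ 2 * normc (f v) ^+ 2)%:E));
    last by move=> v _; rewrite normcM exprMn mulrA.
  apply: esumZ_le => [|v]; last exact: sqr_ge0.
  by apply: mulr_ge0 => //; exact: sqr_ge0.
have g2 : (\esum_(v in setT) (2 * normc (g v) ^+ 2)%:E < +oo)%E.
  apply: (@le_lt_trans _ _ (2%:E * sumsq setT g)%E); last first.
    by rewrite lte_mul_pinfty// lee_fin.
  by apply: esumZ_le => [//|v]; rewrite sqr_ge0.
apply: le_lt_trans (lte_add_pinfty kf g2).
rewrite -esumD; [|by move=> v _; rewrite lee_fin mulr_ge0 ?sqr_ge0..].
by apply: le_esum => v _; rewrite -EFinD lee_fin; exact: sqnormcD.
Qed.

HB.instance Definition _ :=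
  GRing.isSubmodClosed.Build R[i] (V -> R[i]) sqsummable
    sqsummable_submod_closed.

End SumSq.

Record l2 (R : realType) (V : choiceType) := L2 {
  l2_fun :> V -> R[i];
  _ : l2_fun \in @sqsummable R V
}.
Arguments L2 {R V}.

HB.instance Definition _ (R : realType) (V : choiceType) :=
  [isSub for @l2_fun R V].
HB.instance Definition _ (R : realType) (V : choiceType) :=
  [Choice of l2 R V by <:].
HB.instance Definition _ (R : realType) (V : choiceType) :=
  [SubChoice_isSubLmodule of l2 R V by <:].

Section Hilbert.
Variables (R : realType) (V : choiceType).

(* Meaningful for absolutely summable families only: [esum] handles nonnegative
   families, so positive and negative parts are summed separately. *)
Definition rsum (a : V -> R) : R :=
  fine (\esum_(v in setT) (Num.max (a v) 0)%:E)%E -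
  fine (\esum_(v in setT) (Num.max (- a v) 0)%:E)%E.

Definition csum (a : V -> R[i]) : R[i] :=
  (rsum (fun v => complex.Re (a v)) +i* rsum (fun v => complex.Im (a v)))%C.

Definition l2_dot (f g : l2 R V) : R[i] := csum (fun v => f v * (g v)^*%C).

Definition l2_norm (f : l2 R V) : R := Num.sqrt (fine (sumsq setT f)).

Record bounded_op := BoundedOp {
  bop_fun :> {linear l2 R V -> l2 R V};
  _ : exists M : R, forall f, l2_norm (bop_fun f) <= M * l2_norm f
}.

Definition is_adjoint (S S' : bounded_op) : Prop :=
  forall f g, l2_dot (S f) g = l2_dot f (S' g).

Definition centered_family (S S' : bounded_op) : set (l2 R V -> l2 R V) :=
  [set A | exists2 n, (1 <= n)%N &
    A = iter n S \o iter n S' \/ A = iter n S' \o iter n S].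

(* [S'] is the Hilbert space adjoint S^*, unique since [l2_dot] is
   nondegenerate. *)
Definition centered (S : bounded_op) : Prop :=
  exists2 S', is_adjoint S S' &
    forall A B, centered_family S S' A -> centered_family S S' B ->
      A \o B = B \o A.

End Hilbert.

Section WeightedShift.
Variables (R : realType) (V : choiceType) (T : directed_tree V).

(* The value at the root, if there is one, is irrelevant: only non-root
   vertices are children or have a parent. *)
Variable lam : V -> R[i].

Definition bounded_weights : Prop :=
  (ereal_sup [set sumsq (Chi T v) lam | v in setT] < +oo)%E.

(* The product of the weights at v, par v, ..., par^n v; the default value 1
   occurs only when par^n v is undefined. *)
Definition weight_prod (n : nat) (v : V) : R[i] :=
  \prod_(k < n.+1) oapp lam 1 (parn T k v).

Definition wshift_fun (f : V -> R[i]) (v : V) : R[i] :=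
  if par T v is Some u then lam v * f u else 0.

Lemma sumsq_wshift (M : R) f : 0 <= M ->
  (forall u, (sumsq (Chi T u) lam <= M%:E)%E) ->
  (sumsq setT (wshift_fun f) <= M%:E * sumsq setT f)%E.
Proof.
move=> M0 HM; pose a v := ((normc (wshift_fun f v)) ^+ 2)%:E.
have a0 v : (0 <= a v)%E by rewrite lee_fin sqr_ge0.
have -> : sumsq setT (wshift_fun f) = (\esum_(v in [set v | par T v != None]) a v)%E.
  rewrite /sumsq [RHS]esum_mkcond; apply: eq_esum => v _.
  rewrite /a /wshift_fun; case: ifPn => [//|]; rewrite notin_setE /=.
  by case: (par T v) => [//|]; rewrite normc0 expr0n.
have -> : (\esum_(v in [set v | par T v != None]) a v =
           \esum_(u in setT) \esum_(v in Chi T u) a v)%E.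
  rewrite esum_esum//; apply: reindex_esum => //; split.
  - by move=> [u v] /= [_ /parP ->].
  - move=> [u v] [u' v']; rewrite !inE /= => -[_ uv] [_ uv'] e.
    by subst v'; rewrite (edge_parent_uniq uv uv').
  - move=> v /=; case e: (par T v) => [u|//] _.
    by exists (u, v) => //; split=> //; apply/parP.
apply: le_trans (esumZ_le setT M0 (fun v => sqr_ge0 (normc (f v)))).
apply: le_esum => u _.
have -> : (\esum_(v in Chi T u) a v =
  \esum_(v in Chi T u) (normc (f u) ^+ 2 * normc (lam v) ^+ 2)%:E)%E.
  apply: eq_esum => v /parP; rewrite /a /wshift_fun => ->.
  by rewrite normcM exprMn mulrC.
apply: (le_trans (esumZ_le _ _ _)); [exact: sqr_ge0|by move=> v; exact: sqr_ge0|].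
rewrite mulrC EFinM; apply: (lee_wpmul2l _ (HM u)).
by rewrite lee_fin sqr_ge0.
Qed.

Variable lam_bounded : bounded_weights.

Lemma wshift_bound : exists2 M : R, 0 <= M & forall f,
  (sumsq setT (wshift_fun f) <= M%:E * sumsq setT f)%E.
Proof.
move: lam_bounded; rewrite /bounded_weights; set s := ereal_sup _ => sfin.
have mfin : maxe 0%E s \is a fin_num.
  by rewrite ge0_fin_numE ?le_max ?lexx// gt_max ltry.
exists (fine (maxe 0%E s)); first by rewrite fine_ge0// le_max lexx.
move=> f; apply: sumsq_wshift; first by rewrite fine_ge0// le_max lexx.
move=> u; rewrite fineK// le_max; apply/orP; right.
by apply: ereal_sup_ubound; exists u.
Qed.

Lemma wshift_sqsummable (f : l2 R V) : wshift_fun f \in @sqsummable R V.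
Proof.
have [M M0 HM] := wshift_bound; apply/asboolP.
apply: le_lt_trans (HM f) _; rewrite lte_mul_pinfty ?lee_fin//.
exact/asboolP/(valP f).
Qed.

Definition wshift_l2 (f : l2 R V) : l2 R V := L2 _ (wshift_sqsummable f).

Lemma wshift_linear : linear wshift_l2.
Proof.
move=> k f g; apply/val_inj/funext => v.
change (wshift_fun (k *: (f : V -> R[i]) + (g : V -> R[i])) v =
  k * wshift_fun f v + wshift_fun g v).
rewrite /wshift_fun; case: (par T v) => [u|]; last by rewrite mulr0 addr0.
by change (lam v * (k * f u + g u) = k * (lam v * f u) + lam v * g u); ring.
Qed.

HB.instance Definition _ :=
  GRing.isLinear.Build R[i] (l2 R V) (l2 R V) *:%R wshift_l2 wshift_linear.

Lemma wshift_l2_bounded :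
  exists M : R, forall f, l2_norm (wshift_l2 f) <= M * l2_norm f.
Proof.
have [M M0 HM] := wshift_bound; exists (Num.sqrt M) => f.
rewrite /l2_norm -sqrtrM// ler_wsqrtr//.
have ffin : sumsq setT f \is a fin_num.
  by rewrite ge0_fin_numE ?sumsq_ge0//; exact/asboolP/(valP f).
rewrite -lee_fin EFinM !fineK//; first exact: HM.
rewrite ge0_fin_numE ?sumsq_ge0//.
exact/asboolP/(valP (wshift_l2 f)).
Qed.

Definition wshift : bounded_op R V := BoundedOp wshift_l2_bounded.

End WeightedShift.

(* Main.v *)
Require Import Defs.
From HB Require Import structures.
From mathcomp Require Import all_boot all_order all_algebra complex.
From mathcomp Require Import all_classical all_reals ereal esum.
From mathcomp Require Import ring lra.

Set Implicit Arguments.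
Unset Strict Implicit.
Unset Printing Implicit Defensive.
Import Order.TTheory GRing.Theory Num.Theory.
Import ComplexField.Normc.

(** Write S for the shift, par^n for the n-fold parent, and Lambda_n(v) for the
    product of the n weights met when climbing from v to par^n(v).  Then
    (S^n f)(v) = Lambda_n(v) f(par^n v), so that testing the adjoint against
    the basis vector at w gives
    (S*^n g)(w) = sum over par^n(v) = w of g(v) conj(Lambda_n(v)).

    Consequently D_n = S*^n S^n is multiplication by a function d_n of the
    vertex, with d_0 = 1 and d_{n+1}(u) = sum over children y of u of
    |lambda_y|^2 d_n(y) ([adj_shift_diag]); in particular d_1(u) is the sum
    compared in the theorem.  On the other hand P_k = S^k S*^k has the matrix
    entry Lambda_k(v) conj(Lambda_k(v')) at (v, v') when par^k(v) and par^k(v')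
    are defined and equal, and 0 elsewhere.  So D_n commutes with P_k exactly
    when d_n takes the same value at v and v' whenever this entry is nonzero.
    For n = 1 this is the condition of the theorem, which is therefore necessary
    ([centered_balanced]).

    It is sufficient because the condition for d_1 propagates to every d_n
    ([diag_const]): if u1 and u2 are related in this way at distance k, then
    their children carrying nonzero weights are all related at distance k + 1,
    so d_n has a single value c on them by induction, and
    d_{n+1}(ui) = c d_1(ui).  Hence every D_n commutes with every P_k.  The
    D_n commute since they are multiplications, and the P_n commute because
    P_n P_{n+k} = S^n D_n P_k S*^n and P_{n+k} P_n = S^n P_k D_n S*^n
    ([balanced_centered]).

    Sufficiency also calls for the existence of a bounded adjoint
    ([wshift_adjP]).  It is given by the formula above for n = 1; its
    boundedness is a Cauchy-Schwarz estimate at each vertex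
    ([cauchy_schwarz_csum]), and the adjoint identity is the rearrangement of
    an absolutely convergent sum over vertices into a sum over parents of sums
    over children ([csum_fiber]). *)

Local Open Scope classical_set_scope.
Local Open Scope ring_scope.

(** * Unordered real sums *)

Lemma esum_fiber (R : realType) (V W : choiceType) (p : V -> option W)
    (b : V -> \bar R) : (forall v, (0 <= b v)%E) ->
  (\esum_(u in setT) \esum_(v in [set v | p v = Some u]) b v =
   \esum_(v in [set v | p v]) b v)%E.
Proof.
move=> b0; rewrite esum_esum//; symmetry; apply: reindex_esum; split.
- by move=> [u v] /= [_ ->].
- move=> [u v] [u' v']; rewrite !inE /= => -[_ uv] [_ uv'] e.
  by move: uv'; rewrite -e uv => -[->].
- by move=> v /=; case e: (p v) => [u|//] _; exists (u, v).
Qed.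

Lemma esum_pred (R : realType) (V : choiceType) (P : pred V) (b : V -> \bar R) :
  (\esum_(v in [set v | P v]) b v =
   \esum_(v in setT) if P v then b v else 0)%E.
Proof.
rewrite esum_mkcond; apply: eq_esum => v _; congr (if _ then _ else _).
by apply/idP/idP; rewrite inE.
Qed.

Section RealSums.
Variables (R : realType) (V : choiceType).
Implicit Types (a b : V -> R) (c : R).

Definition rsummable a : Prop := (\esum_(v in setT) `|a v|%:E < +oo)%E.

Lemma esum_fin_num a : (forall v, 0 <= a v) -> rsummable a ->
  (\esum_(v in setT) (a v)%:E)%E \is a fin_num.
Proof.
move=> a0; rewrite /rsummable ge0_fin_numE; last first.
  by apply: esum_ge0 => v _; rewrite lee_fin.
by rewrite (eq_esum (b := fun v => (a v)%:E)) // => v _; rewrite ger0_norm.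
Qed.

Lemma rsummable_le a b : (forall v, `|a v| <= `|b v|) -> rsummable b -> rsummable a.
Proof. by move=> ab; apply: le_lt_trans; apply: le_esum => v _; rewrite lee_fin. Qed.

Lemma rsummableD a b : rsummable a -> rsummable b ->
  rsummable (fun v => a v + b v).
Proof.
move=> sa sb; apply: le_lt_trans (lte_add_pinfty sa sb).
by rewrite -esumD//; apply: le_esum => v _; rewrite -EFinD lee_fin ler_normD.
Qed.

Lemma rsummable_pos a : rsummable a -> rsummable (fun v => Num.max (a v) 0).
Proof.
apply: rsummable_le => v.
by rewrite ger0_norm ?le_max ?lexx ?orbT// ge_max ler_norm normr_ge0.
Qed.

Lemma rsummable_neg a : rsummable a -> rsummable (fun v => Num.max (- a v) 0).
Proof.
apply: rsummable_le => v.
by rewrite ger0_norm ?le_max ?lexx ?orbT// ge_max -normrN ler_norm normr_ge0.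
Qed.

Lemma eq_rsum a b : a =1 b -> rsum a = rsum b.
Proof. by move=> /funext ->. Qed.

Lemma esumZ c a : 0 <= c -> (forall v, 0 <= a v) ->
  (\esum_(v in setT) (c * a v)%:E = c%:E * \esum_(v in setT) (a v)%:E)%E.
Proof.
rewrite le_eqVlt => /predU1P[<- _|c0 a0].
  by rewrite mul0e esum1// => v _; rewrite mul0r.
apply/eqP; rewrite eq_le esumZ_le ?(ltW c0)//=.
rewrite -lee_pdivlMl//; apply: le_trans (esumZ_le setT _ _).
- by apply: le_esum => v _; rewrite mulKf ?gt_eqF.
- by rewrite invr_ge0 ltW.
- by move=> v; rewrite mulr_ge0// ltW.
Qed.

(** If P and N are the positive and negative parts of a - b, then P + b = N + a
    is an identity between nonnegative families, which can be summed.  So [rsum]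
    does not depend on the splitting it is computed from, and additivity and
    rearrangement both reduce to nonnegative families. *)
Lemma rsumB a b : (forall v, 0 <= a v) -> (forall v, 0 <= b v) ->
    rsummable a -> rsummable b ->
  rsum (fun v => a v - b v) =
  fine (\esum_(v in setT) (a v)%:E)%E - fine (\esum_(v in setT) (b v)%:E)%E.
Proof.
move=> a0 b0 sa sb; rewrite /rsum; set d := fun v => a v - b v.
have sd : rsummable d.
  by apply: rsummableD => //; apply: rsummable_le sb => v; rewrite normrN.
pose P v := Num.max (d v) 0; pose N v := Num.max (- d v) 0.
have P0 v : 0 <= P v by rewrite le_max lexx orbT.
have N0 v : 0 <= N v by rewrite le_max lexx orbT.
have fP := esum_fin_num P0 (rsummable_pos sd).
have fN := esum_fin_num N0 (rsummable_neg sd).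
have fa := esum_fin_num a0 sa; have fb := esum_fin_num b0 sb.
have : (\esum_(v in setT) (P v)%:E + \esum_(v in setT) (b v)%:E =
        \esum_(v in setT) (N v)%:E + \esum_(v in setT) (a v)%:E)%E.
  rewrite -!esumD; try by move=> v _; rewrite lee_fin.
  apply: eq_esum => v _; rewrite -!EFinD; congr EFin.
  rewrite /P /N /d; have [?|?] := leP (a v - b v) 0;
  have [?|?] := leP (- (a v - b v)) 0; lra.
move=> /(congr1 fine); rewrite !fineD// /P /N; lra.
Qed.

Lemma rsumD a b : rsummable a -> rsummable b ->
  rsum (fun v => a v + b v) = rsum a + rsum b.
Proof.
move=> sa sb.
pose P (x : V -> R) v := Num.max (x v) 0; pose N (x : V -> R) v := Num.max (- x v) 0.
have P0 x v : 0 <= P x v by rewrite le_max lexx orbT.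
have N0 x v : 0 <= N x v by rewrite le_max lexx orbT.
rewrite (@eq_rsum _ (fun v => (P a v + P b v) - (N a v + N b v))); last first.
  move=> v; rewrite /P /N; have [?|?] := leP (a v) 0; have [?|?] := leP (- a v) 0;
  have [?|?] := leP (b v) 0; have [?|?] := leP (- b v) 0; lra.
have fPa := esum_fin_num (P0 a) (rsummable_pos sa).
have fPb := esum_fin_num (P0 b) (rsummable_pos sb).
have fNa := esum_fin_num (N0 a) (rsummable_neg sa).
have fNb := esum_fin_num (N0 b) (rsummable_neg sb).
(* The sum of the positive parts is in general larger than the positive part of
   the sum, so this splitting is not the one defining [rsum]. *)
rewrite rsumB; first last.
- by apply: rsummableD; exact: rsummable_neg.
- by apply: rsummableD; exact: rsummable_pos.
- by move=> v; rewrite addr_ge0.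
- by move=> v; rewrite addr_ge0.
under eq_esum do rewrite EFinD.
rewrite esumD; try by move=> v _; rewrite lee_fin.
under [in X in _ - X]eq_esum do rewrite EFinD.
rewrite esumD; try by move=> v _; rewrite lee_fin.
rewrite !fineD// /rsum /P /N; ring.
Qed.

Lemma rsumN a : rsum (fun v => - a v) = - rsum a.
Proof.
rewrite /rsum opprB; congr (_ - fine _).
by apply: eq_esum => v _; rewrite opprK.
Qed.

(** For a divergent family this rests on [fine] sending an infinite sum to 0,
    which multiplication by a constant preserves.  The diagonal functions below
    can thus be computed without any convergence argument. *)
Lemma rsumZ c a : rsum (fun v => c * a v) = c * rsum a.
Proof.
wlog c0 : c / 0 <= c => [hw|].
  have [/hw//|/ltW c0] := leP 0 c.
  rewrite -[c]opprK mulNr -hw ?oppr_ge0// -rsumN.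
  by apply: eq_rsum => v; rewrite mulNr.
have maxZ x : Num.max (c * x) 0 = c * Num.max x 0 by rewrite maxr_pMr// mulr0.
have max0 (x : R) : 0 <= Num.max x 0 by rewrite le_max lexx orbT.
rewrite /rsum.
under eq_esum do rewrite maxZ.
under [in X in _ - X]eq_esum do rewrite -mulrN maxZ.
have fineZ (x : \bar R) : fine (c%:E * x)%E = c * fine x.
  move: c0; rewrite le_eqVlt => /predU1P[<-|c0]; first by rewrite mul0e mul0r.
  by case: x => [x| |] //=;
    [rewrite gt0_muley|rewrite gt0_muleNy]; rewrite ?mulr0 ?lte_fin.
rewrite !esumZ// !fineZ; ring.
Qed.

Lemma rsum_ge0 a : (forall v, 0 <= a v) ->
  rsum a = fine (\esum_(v in setT) (a v)%:E)%E.
Proof.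
move=> a0; rewrite /rsum [X in _ - fine X]esum1 ?subr0; last first.
  by move=> v _; congr EFin; apply: max_r; rewrite oppr_le0.
by congr fine; apply: eq_esum => v _; congr EFin; apply: max_l.
Qed.

Lemma rsum_delta c (u : V) : rsum (fun v => if v == u then c else 0) = c.
Proof.
rewrite (@eq_rsum _ (fun v => c * (if v == u then 1 else 0))); last first.
  by move=> v; case: eqP; rewrite ?mulr1 ?mulr0.
rewrite rsumZ rsum_ge0; last by move=> v; case: eqP.
rewrite (eq_esum (b := fun v => if v == u then 1%E else 0%E)); last first.
  by move=> v _; case: eqP.
rewrite -esum_pred (_ : [set v | v == u] = [set u]) ?esum_set1 ?mulr1//.
by apply/seteqP; split=> v /eqP.
Qed.

Lemma ler_norm_rsum a : rsummable a ->
  `|rsum a| <= fine (\esum_(v in setT) `|a v|%:E)%E.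
Proof.
move=> sa.
have max0 (x : R) : 0 <= Num.max x 0 by rewrite le_max lexx orbT.
have sN : rsummable (fun v => `|a v|) by apply: rsummable_le sa => v; rewrite normr_id.
have h b : rsummable b -> (forall v, 0 <= b v) -> (forall v, b v <= `|a v|) ->
    0 <= fine (\esum_(v in setT) (b v)%:E)%E <= fine (\esum_(v in setT) `|a v|%:E)%E.
  move=> sb b0 ba; rewrite fine_ge0/=; last by apply: esum_ge0 => v _; rewrite lee_fin.
  rewrite fine_le ?esum_fin_num//.
  by apply: le_esum => v _; rewrite lee_fin.
have leP v : Num.max (a v) 0 <= `|a v| by rewrite ge_max ler_norm normr_ge0.
have leN v : Num.max (- a v) 0 <= `|a v|.
  by rewrite ge_max -normrN ler_norm normr_ge0.
have /andP[? ?] := h _ (rsummable_pos sa) (fun v => max0 _) leP.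
have /andP[? ?] := h _ (rsummable_neg sa) (fun v => max0 _) leN.
by rewrite /rsum ler_norml; apply/andP; split; lra.
Qed.

(** A summable family may be summed fiber by fiber: this holds for the positive
    and negative parts by [esum_fiber], and [rsumB] puts them together. *)
Lemma rsum_fiber (p : V -> option V) a : rsummable a ->
    (forall v, p v = None -> a v = 0) ->
  rsum a = rsum (fun u => rsum (fun v => if p v == Some u then a v else 0)).
Proof.
move=> sa a0.
have key b : (forall v, 0 <= b v) -> rsummable b -> (forall v, p v = None -> b v = 0) ->
  let B u := rsum (fun v => if p v == Some u then b v else 0) in
  [/\ forall u, 0 <= B u, rsummable B &
   (\esum_(v in setT) (B v)%:E = \esum_(v in setT) (b v)%:E)%E].
  move=> b0 sb bN B.
  have BE u : (B u)%:E = (\esum_(v in [set v | p v = Some u]) (b v)%:E)%E.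
    rewrite /B rsum_ge0; last by move=> v; case: eqP.
    rewrite fineK; last first.
      apply: esum_fin_num => [v|]; first by case: eqP.
      by apply: rsummable_le sb => v; case: eqP; rewrite ?normr0.
    rewrite (_ : [set v | p v = Some u] = [set v | p v == Some u]).
      by rewrite esum_pred; apply: eq_esum => v _; case: eqP.
    by apply/seteqP; split=> v /eqP.
  have B0 u : 0 <= B u.
    by rewrite -lee_fin BE esum_ge0// => v _; rewrite lee_fin.
  have EB : (\esum_(v in setT) (B v)%:E = \esum_(v in setT) (b v)%:E)%E.
    rewrite (eq_esum (fun u _ => BE u)) esum_fiber; last by move=> v; rewrite lee_fin.
    by rewrite esum_pred; apply: eq_esum => v _; case e: (p v) => //; rewrite bN.
  split=> //; rewrite /rsummable.
  rewrite (eq_esum (b := fun v => (B v)%:E)) ?EB; last first.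
    by move=> v _; rewrite ger0_norm.
  by rewrite (eq_esum (b := fun v => `|b v|%:E))// => v _; rewrite ger0_norm.
have max0 (x : R) : 0 <= Num.max x 0 by rewrite le_max lexx orbT.
have [||P0 sP EP] := key (fun v => Num.max (a v) 0) _ (rsummable_pos sa).
- by move=> v.
- by move=> v /a0 ->; rewrite maxxx.
have [||N0 sN EN] := key (fun v => Num.max (- a v) 0) _ (rsummable_neg sa).
- by move=> v.
- by move=> v /a0 ->; rewrite oppr0 maxxx.
(* The fiber sums of the two parts again split the family of fiber sums into
   summable nonnegative families. *)
rewrite [LHS]/rsum -EP -EN -rsumB//; apply: eq_rsum => u.
rewrite -rsumN -rsumD.
- apply: eq_rsum => v; case: eqP => _; last by rewrite subr0.
  by have [?|?] := leP (a v) 0; have [?|?] := leP (- a v) 0; lra.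
- by apply: rsummable_le (rsummable_pos sa) => v; case: eqP; rewrite ?normr0.
- by apply: rsummable_le (rsummable_neg sa) => v; case: eqP; rewrite normrN ?normr0.
Qed.

End RealSums.

(** * Unordered complex sums *)

Section ComplexSums.
Variables (R : realType) (V : choiceType).
Implicit Types (a b f g : V -> R[i]) (z : R[i]).

Lemma sqr_normcE z : normc z ^+ 2 = complex.Re z ^+ 2 + complex.Im z ^+ 2.
Proof. by case: z => x y /=; rewrite sqr_sqrtr ?addr_ge0 ?sqr_ge0. Qed.

Lemma normc_ge0 z : 0 <= normc z.
Proof. by case: z => x y; exact: sqrtr_ge0. Qed.

Lemma normc_conj z : normc z^*%C = normc z.
Proof. by case: z => x y /=; rewrite sqrrN. Qed.

Lemma mul_conjc z : z * z^*%C = ((normc z ^+ 2)%:C)%C.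
Proof.
by rewrite sqr_normcE; case: z => x y; apply/eqP; rewrite eq_complex /=;
   apply/andP; split; apply/eqP; ring.
Qed.

Lemma normr_Re_le z : `|complex.Re z| <= normc z.
Proof.
rewrite -[leRHS]ger0_norm ?normc_ge0// -ler_sqr ?nnegrE// !real_normK ?num_real//.
by rewrite sqr_normcE lerDl sqr_ge0.
Qed.

Lemma normr_Im_le z : `|complex.Im z| <= normc z.
Proof.
rewrite -[leRHS]ger0_norm ?normc_ge0// -ler_sqr ?nnegrE// !real_normK ?num_real//.
by rewrite sqr_normcE lerDr sqr_ge0.
Qed.

Definition csummable a : Prop := rsummable (fun v => normc (a v)).

Lemma csummable_le a b : (forall v, normc (a v) <= normc (b v)) ->
  csummable b -> csummable a.
Proof.
by move=> ab; apply: rsummable_le => v; rewrite !ger0_norm ?normc_ge0.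
Qed.

Lemma csummable_Re a : csummable a -> rsummable (fun v => complex.Re (a v)).
Proof.
by apply: rsummable_le => v; rewrite (ger0_norm (normc_ge0 _)) normr_Re_le.
Qed.

Lemma csummable_Im a : csummable a -> rsummable (fun v => complex.Im (a v)).
Proof.
by apply: rsummable_le => v; rewrite (ger0_norm (normc_ge0 _)) normr_Im_le.
Qed.

Lemma eq_csum a b : a =1 b -> csum a = csum b.
Proof. by move=> /funext ->. Qed.

Lemma csumD a b : csummable a -> csummable b ->
  csum (fun v => a v + b v) = csum a + csum b.
Proof.
move=> sa sb; apply/eqP; rewrite eq_complex /= -!rsumD; try exact: csummable_Re;
  try exact: csummable_Im.
by apply/andP; split; apply/eqP/eq_rsum => v; rewrite raddfD.
Qed.

Lemma csumZ z a : csummable a -> csum (fun v => z * a v) = z * csum a.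
Proof.
move=> sa; have sZ c (x : V -> R) : rsummable x -> rsummable (fun v => c * x v).
  move=> sx; rewrite /rsummable.
  under eq_esum do rewrite normrM.
  by rewrite esumZ// lte_mul_pinfty.
have [sR sI] := (csummable_Re sa, csummable_Im sa).
case: z => x y; rewrite /csum; apply/eqP; rewrite eq_complex /=.
rewrite -[x * _]rsumZ -[y * rsum (fun v => complex.Im _)]rsumZ.
rewrite -[x * _]rsumZ -[y * rsum _]rsumZ.
rewrite -rsumN -!rsumD; try exact: sZ; last first.
  by apply: rsummable_le (sZ y _ sI) => v; rewrite normrN.
by apply/andP; split; apply/eqP/eq_rsum => v; case: (a v).
Qed.

Lemma csum_real (a : V -> R) z :
  csum (fun v => ((a v)%:C)%C * z) = ((rsum a)%:C)%C * z.
Proof.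
case: z => x y; rewrite /csum; apply/eqP; rewrite eq_complex /=.
rewrite !mul0r subr0 addr0 ![rsum a * _]mulrC -!rsumZ.
by apply/andP; split; apply/eqP/eq_rsum => v /=; ring.
Qed.

Lemma csum_conj a : csum (fun v => (a v)^*%C) = (csum a)^*%C.
Proof.
rewrite /csum /=; congr (_ +i* _)%C; last rewrite -rsumN;
  by apply: eq_rsum => v; case: (a v).
Qed.

Lemma csum_delta z (u : V) : csum (fun v => if v == u then z else 0) = z.
Proof.
rewrite -[RHS](_ : (complex.Re z +i* complex.Im z)%C = z); last by case: z.
rewrite /csum -[in RHS](rsum_delta (complex.Re z) u).
rewrite -[in RHS](rsum_delta (complex.Im z) u).
by congr (_ +i* _)%C; apply: eq_rsum => v; case: eqP.
Qed.

Lemma csum_fiber (p : V -> option V) a : csummable a ->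
    (forall v, p v = None -> a v = 0) ->
  csum a = csum (fun u => csum (fun v => if p v == Some u then a v else 0)).
Proof.
move=> sa a0; rewrite /csum /=.
rewrite (rsum_fiber (p := p) (csummable_Re sa)); last by move=> v /a0 ->.
rewrite [X in (_ +i* X)%C](rsum_fiber (p := p) (csummable_Im sa)); last first.
  by move=> v /a0 ->.
by congr (_ +i* _)%C; apply: eq_rsum => u; apply: eq_rsum => v; case: eqP.
Qed.

Lemma csummable_mul f g : sqsummable f -> sqsummable g ->
  csummable (fun v => f v * (g v)^*%C).
Proof.
move=> /asboolP sf /asboolP sg; apply: le_lt_trans (lte_add_pinfty sf sg).
rewrite -esumD; try by move=> v _; rewrite lee_fin sqr_ge0.
apply: le_esum => v _; rewrite -EFinD lee_fin normcM normc_conj.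
rewrite ger0_norm ?mulr_ge0 ?normc_ge0//.
have : 0 <= (normc (f v) - normc (g v)) ^+ 2 by rewrite sqr_ge0.
have := sqr_ge0 (normc (f v)); have := sqr_ge0 (normc (g v)); nra.
Qed.

(** The factor 2 comes from bounding the real and imaginary parts of the sum
    separately.  A positive bound M on the second factor, in place of its value,
    keeps the quotient in the proof meaningful when that factor vanishes. *)
Lemma cauchy_schwarz_csum f g (M : R) : sqsummable f -> 0 < M ->
    (sumsq setT g <= M%:E)%E ->
  ((normc (csum (fun v => f v * (g v)^*%C)) ^+ 2)%:E <=
   (2 * M)%:E * sumsq setT f)%E.
Proof.
move=> sf M0 gM.
have sg : sqsummable g by apply/asboolP; apply: le_lt_trans gM (ltry _).
have sfg := csummable_mul sf sg.
pose X := fine (\esum_(v in setT) (normc (f v * (g v)^*%C))%:E)%E.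
have XE : (\esum_(v in setT) (normc (f v * (g v)^*%C))%:E)%E = X%:E.
  by rewrite fineK//; apply: esum_fin_num => // v; exact: normc_ge0.
have X0 : 0 <= X by rewrite fine_ge0// esum_ge0// => v _; rewrite lee_fin normc_ge0.
have ffin : sumsq setT f \is a fin_num.
  by rewrite ge0_fin_numE ?sumsq_ge0//; exact/asboolP.
rewrite -(fineK ffin) -EFinM lee_fin; set F := fine _.
have XF : X ^+ 2 <= M * F.
  (* Sum 2 s |f| |g| <= |f|^2 + s^2 |g|^2 over the vertices; s = X / M
     optimises the outcome 2 s X <= F + s^2 M. *)
  pose s := X / M.
  have s0 : 0 <= s by rewrite divr_ge0// ltW.
  have : (2 * s * X <= F + s ^+ 2 * M)%R.
    rewrite -lee_fin EFinD EFinM -XE -esumZ; first last.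
    - by move=> v; exact: normc_ge0.
    - by rewrite mulr_ge0.
    rewrite /F fineK//.
    apply: (@le_trans _ _ (sumsq setT f + (s ^+ 2)%:E * sumsq setT g)%E); last first.
      by rewrite leeD2l// (EFinM _ M) lee_wpmul2l// lee_fin sqr_ge0.
    rewrite -esumZ ?sqr_ge0//; last by move=> v; exact: sqr_ge0.
    rewrite -esumD; first last.
    - by move=> v _; rewrite lee_fin mulr_ge0 ?sqr_ge0.
    - by move=> v _; rewrite lee_fin sqr_ge0.
    apply: le_esum => v _; rewrite -EFinD lee_fin normcM normc_conj.
    have := sqr_ge0 (normc (f v) - s * normc (g v)); nra.
  have -> : s ^+ 2 * M = s * X by rewrite /s; field; rewrite gt_eqF.
  have -> : 2 * s * X = s * X + s * X by ring.
  rewrite lerD2r /s mulrAC -expr2 ler_pdivrMr// mulrC//.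
have bd (x : V -> R) : (forall v, `|x v| <= normc (f v * (g v)^*%C)) ->
    rsum x ^+ 2 <= M * F.
  move=> xb; apply: le_trans XF; rewrite -[leLHS]real_normK ?num_real// ler_sqr ?nnegrE//.
  have sx : rsummable x.
    by apply: rsummable_le sfg => v; rewrite (ger0_norm (normc_ge0 _)).
  apply: le_trans (ler_norm_rsum sx) _.
  have sx' : rsummable (fun v => `|x v|) by apply: rsummable_le sx => v; rewrite normr_id.
  rewrite fine_le//; [exact: esum_fin_num|by rewrite XE|].
  by apply: le_esum => v _; rewrite lee_fin.
rewrite sqr_normcE /csum /=.
have := bd _ (fun v => normr_Re_le _); have := bd _ (fun v => normr_Im_le _); lra.
Qed.

End ComplexSums.

(** * Inner product and basis vectors *)

Section InnerProduct.
Variables (R : realType) (V : choiceType).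
Implicit Types (f g h : l2 R V) (u : V).

Lemma l2_sqsummable f : sqsummable f.
Proof. exact: valP. Qed.

Lemma l2_ext f g : (forall v, f v = g v) -> f = g.
Proof. by move=> fg; apply/val_inj/funext. Qed.

Lemma l2_linE (k : R[i]) f g v : (k *: f + g) v = k * f v + g v.
Proof. by []. Qed.

Definition delta_fun u v : R[i] := if v == u then 1 else 0.

Lemma delta_sqsummable u : delta_fun u \in @sqsummable R V.
Proof.
apply/asboolP; rewrite /sumsq.
rewrite (eq_esum (b := fun v => if v == u then 1%E else 0%E)); last first.
  move=> v _; rewrite /delta_fun; case: eqP => _.
    by rewrite normc1 expr1n.
  by rewrite normc0 expr0n.
rewrite -esum_pred (_ : [set v | v == u] = [set u]) ?esum_set1 ?ltry//.
by apply/seteqP; split=> v /eqP.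
Qed.

Definition delta u : l2 R V := L2 _ (delta_sqsummable u).

Lemma deltaE u v : delta u v = if v == u then 1 else 0.
Proof. by []. Qed.

Lemma l2_dot_delta f u : l2_dot f (delta u) = f u.
Proof.
rewrite -[RHS](csum_delta (f u) u); apply: eq_csum => v.
by rewrite deltaE; case: eqP => [->|_]; rewrite ?conjc1 ?mulr1 ?conjc0 ?mulr0.
Qed.

Lemma l2_dotC f g : l2_dot g f = (l2_dot f g)^*%C.
Proof.
by rewrite -csum_conj; apply: eq_csum => v; rewrite rmorphM /= conjcK mulrC.
Qed.

Lemma adjoint_iter (S S' : bounded_op R V) n f g : is_adjoint S S' ->
  l2_dot (iter n S f) g = l2_dot f (iter n S' g).
Proof. by move=> SS'; elim: n g => //= n IH g; rewrite SS' IH -iterS iterSr. Qed.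

(** Testing against basis vectors recovers every power of the adjoint from the
    powers of the operator. *)
Lemma adjoint_iterE (S S' : bounded_op R V) n g u : is_adjoint S S' ->
  iter n S' g u = l2_dot g (iter n S (delta u)).
Proof.
by move=> SS'; rewrite l2_dotC (adjoint_iter _ _ _ SS') -l2_dotC l2_dot_delta.
Qed.

End InnerProduct.

(** * The adjoint of a weighted shift *)

Section Adjoint.
Variables (R : realType) (V : choiceType) (T : directed_tree V).
Variables (lam : V -> R[i]) (lam_bounded : bounded_weights T lam).

(** The column of the matrix of the shift at [u], that is, the image of the
    basis vector at [u]. *)
Definition child_weight (u v : V) : R[i] := if par T v == Some u then lam v else 0.

Lemma sumsq_fiber (h : V -> R[i]) u :
  sumsq setT (fun v => if par T v == Some u then h v else 0) = sumsq (Chi T u) h.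
Proof.
rewrite /sumsq (_ : Chi T u = [set v | par T v == Some u]).
  rewrite esum_pred; apply: eq_esum => v _.
  by case: eqP => // _; rewrite normc0 expr0n.
by apply/seteqP; split=> v; [move=> /parP uv; apply/eqP|move=> /eqP/parP].
Qed.

Lemma weights_bound : exists2 M : R, 0 < M &
  forall u, (sumsq (Chi T u) lam <= M%:E)%E.
Proof.
move: lam_bounded; rewrite /bounded_weights; set s := ereal_sup _ => sfin.
have mfin : maxe 1%E s \is a fin_num.
  by rewrite ge0_fin_numE ?le_max ?lee01// gt_max ltry.
exists (fine (maxe 1%E s)).
  by rewrite -lte_fin fineK// lt_max lte01.
move=> u; rewrite fineK// le_max; apply/orP; right.
by apply: ereal_sup_ubound; exists u.
Qed.

Definition adj_fun (g : V -> R[i]) (u : V) : R[i] :=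
  csum (fun v => g v * (child_weight u v)^*%C).

(** The value at [u] only sees the restriction of [g] to the children of [u],
    whose squared norm controls it by Cauchy-Schwarz.  Each vertex has at most
    one parent, so these squared norms add up to at most that of [g]. *)
Lemma sumsq_adj_fun (M : R) (g : V -> R[i]) : 0 < M ->
    (forall u, (sumsq (Chi T u) lam <= M%:E)%E) -> sqsummable g ->
  (sumsq setT (adj_fun g) <= (2 * M)%:E * sumsq setT g)%E.
Proof.
move=> M0 HM sg; pose gu u v := if par T v == Some u then g v else 0.
have guE u : sumsq setT (gu u) = sumsq (Chi T u) g by exact: sumsq_fiber.
have guT : (\esum_(u in setT) sumsq setT (gu u) <= sumsq setT g)%E.
  rewrite (eq_esum (b := fun u =>
      \esum_(v in [set v | par T v = Some u]) (normc (g v) ^+ 2)%:E)%E).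
    rewrite esum_fiber; last by move=> v; rewrite lee_fin sqr_ge0.
    rewrite esum_pred; apply: le_esum => v _.
    by case: ifP => // _; rewrite lee_fin sqr_ge0.
  move=> u _; rewrite guE /sumsq; congr (esum _ _).
  by apply/seteqP; split=> v /parP.
have sgu u : sqsummable (gu u).
  move/asboolP: (sg) => sg'; apply/asboolP; apply: le_lt_trans sg'.
  apply: le_esum => v _; rewrite lee_fin /gu; case: eqP => // _.
  by rewrite normc0 expr0n sqr_ge0.
have gfin u : sumsq setT (gu u) \is a fin_num.
  by rewrite ge0_fin_numE ?sumsq_ge0//; exact/asboolP/(sgu u).
apply: (@le_trans _ _ (\esum_(u in setT) (2 * M * fine (sumsq setT (gu u)))%:E)%E).
  apply: le_esum => u _; rewrite (EFinM (2 * M)) fineK//.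
  (* Truncating [g] to the children of [u] first is what localises the
     estimate. *)
  rewrite /adj_fun (eq_csum (b := fun v => gu u v * (child_weight u v)^*%C)).
    by apply: cauchy_schwarz_csum => //; rewrite sumsq_fiber.
  by move=> v; rewrite /gu /child_weight; case: eqP => // _; rewrite conjc0 !mulr0.
rewrite esumZ; first last.
- by move=> u; rewrite fine_ge0// sumsq_ge0.
- by rewrite mulr_ge0// ltW.
apply: lee_wpmul2l; first by rewrite lee_fin mulr_ge0// ltW.
by under eq_esum do rewrite fineK//.
Qed.

Lemma adj_fun_bound : exists2 M : R, 0 <= M & forall g, sqsummable g ->
  (sumsq setT (adj_fun g) <= M%:E * sumsq setT g)%E.
Proof.
have [M M0 HM] := weights_bound; exists (2 * M); first by rewrite mulr_ge0// ltW.
by move=> g; exact: sumsq_adj_fun.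
Qed.

Lemma adj_sqsummable (g : l2 R V) : adj_fun g \in @sqsummable R V.
Proof.
have [M M0 HM] := adj_fun_bound; apply/asboolP.
apply: le_lt_trans (HM _ (l2_sqsummable g)) _; rewrite lte_mul_pinfty ?lee_fin//.
exact/asboolP/(valP g).
Qed.

Definition adj_l2 (g : l2 R V) : l2 R V := L2 _ (adj_sqsummable g).

Lemma child_weight_sqsummable u : sqsummable (child_weight u).
Proof.
have [M _ HM] := weights_bound; apply/asboolP.
by rewrite sumsq_fiber; exact: le_lt_trans (HM u) (ltry _).
Qed.

Lemma adj_linear : linear adj_l2.
Proof.
move=> k f g; apply: l2_ext => u; rewrite l2_linE /= /adj_fun.
have sf := csummable_mul (l2_sqsummable f) (child_weight_sqsummable u).
have sg := csummable_mul (l2_sqsummable g) (child_weight_sqsummable u).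
have skf := csummable_mul (l2_sqsummable (k *: f)) (child_weight_sqsummable u).
rewrite -csumZ// -csumD//; last first.
  by apply: csummable_le skf => v; rewrite mulrA.
by apply: eq_csum => v; rewrite mulrA -mulrDl.
Qed.

HB.instance Definition _ :=
  GRing.isLinear.Build R[i] (l2 R V) (l2 R V) *:%R adj_l2 adj_linear.

Lemma adj_l2_bounded : exists M : R, forall f, l2_norm (adj_l2 f) <= M * l2_norm f.
Proof.
have [M M0 HM] := adj_fun_bound; exists (Num.sqrt M) => f.
have fin (h : l2 R V) : sumsq setT h \is a fin_num.
  by rewrite ge0_fin_numE ?sumsq_ge0//; exact/asboolP/(valP h).
rewrite /l2_norm -sqrtrM// ler_wsqrtr// -lee_fin EFinM !fineK//.
exact: HM (l2_sqsummable f).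
Qed.

Definition wshift_adj : bounded_op R V := BoundedOp adj_l2_bounded.

(** Both sides are the sum of [lam v * f (par v) * conj (g v)]: over all [v] on
    the left, grouped by the parent of [v] on the right. *)
Lemma wshift_adjP : is_adjoint (wshift lam_bounded) wshift_adj.
Proof.
move=> f g; pose a v := wshift_fun T lam f v * (g v)^*%C.
have sa : csummable a.
  exact: csummable_mul (l2_sqsummable (wshift_l2 lam_bounded f)) (l2_sqsummable g).
have a0 v : par T v = None -> a v = 0.
  by rewrite /a /wshift_fun => ->; rewrite mul0r.
rewrite -[LHS]/(csum a) (csum_fiber sa a0) /l2_dot; apply: eq_csum => u.
rewrite -[wshift_adj g u]/(adj_fun g u) -csum_conj -csumZ; last first.
  have := csummable_mul (child_weight_sqsummable u) (l2_sqsummable g).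
  by apply: csummable_le => v; rewrite rmorphM /= conjcK mulrC.
apply: eq_csum => v; rewrite rmorphM /= conjcK /a /wshift_fun /child_weight.
by case: eqP => [->|_]; [ring|rewrite !mulr0].
Qed.

End Adjoint.

(** * Powers of a weighted shift and of its adjoint *)

Section Centered.
Variables (R : realType) (V : choiceType) (T : directed_tree V).
Variables (lam : V -> R[i]) (lam_bounded : bounded_weights T lam).
Local Notation S := (wshift lam_bounded).

Definition path_weight (n : nat) (v : V) : R[i] :=
  \prod_(k < n) oapp lam 1 (parn T k v).

Lemma parnS n v u : par T v = Some u -> parn T n.+1 v = parn T n u.
Proof. by rewrite /parn iterSr /= => ->. Qed.

Lemma path_weightS n v u : par T v = Some u ->
  path_weight n.+1 v = lam v * path_weight n u.
Proof.
move=> vu; rewrite /path_weight big_ord_recl /=; congr (_ * _).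
by apply: eq_bigr => i _; rewrite -(parnS i vu).
Qed.

Lemma wshift_iterE n f v :
  iter n S f v = if parn T n v is Some w then path_weight n v * f w else 0.
Proof.
elim: n v => [|n IH] v; first by rewrite /= /path_weight big_ord0 mul1r.
rewrite iterS -[LHS]/(wshift_fun T lam (iter n S f) v) /wshift_fun.
case e: (par T v) => [u|].
  rewrite IH (parnS _ e) (path_weightS _ e).
  by case: (parn T n u) => [w|]; rewrite ?mulr0// mulrA.
suff -> : parn T n.+1 v = None by [].
by rewrite /parn iterSr /= e; elim: n {IH} => //= n ->.
Qed.

Variables (S' : bounded_op R V) (SS' : is_adjoint S S').

Lemma adj_iterE n g w : iter n S' g w =
  csum (fun v => if parn T n v == Some w then g v * (path_weight n v)^*%C else 0).
Proof.
rewrite (adjoint_iterE _ _ _ SS'); apply: eq_csum => v; rewrite wshift_iterE.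
case: (parn T n v) => [x|]; last by rewrite conjc0 mulr0.
rewrite deltaE (inj_eq Some_inj); case: eqP => _; first by rewrite mulr1.
by rewrite mulr0 conjc0 mulr0.
Qed.

Definition weighted_child_sum (a : V -> R) (u : V) : R :=
  rsum (fun v => if par T v == Some u then normc (lam v) ^+ 2 * a v else 0).

(** The diagonal of S*^n S^n in the basis of vertices. *)
Definition diag n : V -> R := iter n weighted_child_sum (fun=> 1).

(** Peeling off the innermost factor S and the outermost factor S*, the
    induction step says that S* M S is diagonal when M is: its value at [u] is
    the sum of those of M over the children of [u], weighted by |lam|^2. *)
Lemma adj_shift_diag n f u :
  iter n S' (iter n S f) u = ((diag n u)%:C)%C * f u.
Proof.
elim: n f u => [|n IH] f u; first by rewrite /= mul1r.
rewrite (iterS n S') (iterSr n S) -[S' _]/(iter 1 S' _) adj_iterE /= -csum_real.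
apply: eq_csum => v; rewrite IH /= /wshift_fun -/(diag n).
case e: (par T v) => [x|]; last by rewrite mul0r.
case: eqP => [[->]|_]; last by rewrite mul0r.
rewrite /path_weight big_ord1 /= rmorphM /= -mul_conjc; ring.
Qed.

Lemma weighted_child_sum1 u : weighted_child_sum (fun=> 1) u = fine (sumsq (Chi T u) lam).
Proof.
rewrite -sumsq_fiber /weighted_child_sum rsum_ge0; last first.
  by move=> v; case: eqP => // _; rewrite mulr1 sqr_ge0.
congr fine; apply: eq_esum => v _; case: eqP => _; rewrite ?mulr1//.
by rewrite normc0 expr0n.
Qed.

Lemma sumsq_Chi_fin u : sumsq (Chi T u) lam \is a fin_num.
Proof.
have [M _ HM] := weights_bound lam_bounded.
by rewrite ge0_fin_numE ?sumsq_ge0//; exact: le_lt_trans (HM u) (ltry _).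
Qed.

(** The condition of the theorem in terms of [path_weight].  The distance 0 is
    allowed, where it holds trivially, because the induction in [diag_const]
    moves freely between distances. *)
Definition balanced : Prop := forall (u1 u2 : V) n w,
  parn T n u1 = Some w -> parn T n u2 = Some w ->
  path_weight n u1 != 0 -> path_weight n u2 != 0 ->
  weighted_child_sum (fun=> 1) u1 = weighted_child_sum (fun=> 1) u2.

(** Passing from [n] to [n.+1] uses the statement for [n] one generation below:
    children of [u1] and [u2] with nonzero weights have a common ancestor at
    distance [k.+1]. *)
Lemma diag_const : balanced -> forall n k u1 u2 w,
  parn T k u1 = Some w -> parn T k u2 = Some w ->
  path_weight k u1 != 0 -> path_weight k u2 != 0 ->
  diag n u1 = diag n u2.
Proof.
move=> bal; elim=> [//|n IH] k u1 u2 w p1 p2 w1 w2.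
pose heavy y := lam y != 0 /\ (par T y = Some u1 \/ par T y = Some u2).
(* When no child has a nonzero weight any [d] will do, both sums being 0. *)
have [d hd] : exists d, forall y, heavy y -> diag n y = d.
  have [[y0 hy0]|no] := pselect (exists y, heavy y); last first.
    by exists 0 => y hy; case: no; exists y.
  have lift y : heavy y -> parn T k.+1 y = Some w /\ path_weight k.+1 y != 0.
    by move=> [ly [] py]; rewrite (parnS _ py) (path_weightS _ py) mulf_neq0.
  exists (diag n y0) => y /lift[py wy]; have [p0 w0] := lift _ hy0.
  exact: IH py p0 wy w0.
have step u : u = u1 \/ u = u2 -> diag n.+1 u = d * weighted_child_sum (fun=> 1) u.
  move=> uu; rewrite /= -/(diag n) /weighted_child_sum -rsumZ; apply: eq_rsum => y.
  case: eqP => [py|_]; last by rewrite mulr0.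
  have [->|ly] := eqVneq (lam y) 0; first by rewrite normc0 expr0n/= !(mul0r, mulr0).
  rewrite (hd y) ?mulr1 1?mulrC//; split=> //.
  by case: uu => <-; [left|right].
by rewrite (step u1) ?(step u2)//; [rewrite (bal u1 u2 k w)|right|left].
Qed.

(** At a vertex [v] with k-th ancestor [w], applying P_k to [f] only involves
    the vertices [y] below [w] with nonzero [path_weight], where [diag n] equals
    its value at [v]; this constant can be moved in and out of the sum. *)
Lemma diag_commute : balanced -> forall n k f,
  iter n S' (iter n S (iter k S (iter k S' f))) =
  iter k S (iter k S' (iter n S' (iter n S f))).
Proof.
move=> bal n k f; apply: l2_ext => v; rewrite adj_shift_diag 2!wshift_iterE.
case e: (parn T k v) => [w|]; last by rewrite mulr0.
have [->|wv] := eqVneq (path_weight k v) 0; first by rewrite !mul0r mulr0.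
rewrite mulrCA; congr (_ * _); rewrite !(adjoint_iterE _ _ _ SS').
set x := iter k S (delta R w).
rewrite /l2_dot -csumZ; last exact: csummable_mul (l2_sqsummable f) (l2_sqsummable x).
apply: eq_csum => y; rewrite adj_shift_diag mulrA.
rewrite /x wshift_iterE; case ey: (parn T k y) => [z|]; last by rewrite conjc0 !mulr0.
rewrite deltaE; case: eqP => [zw|_]; last by rewrite mulr0 conjc0 !mulr0.
have [->|wy] := eqVneq (path_weight k y) 0; first by rewrite mul0r conjc0 !mulr0.
by rewrite (diag_const bal n e _ wv wy)// ey zw.
Qed.

(** Putting D_n P_k = P_k D_n between S^n and S*^n makes P_n commute with
    P_(n + k); the D_n commute because they are all diagonal. *)
Lemma balanced_centered : balanced -> forall A B,
  centered_family S S' A -> centered_family S S' B -> A \o B = B \o A.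
Proof.
move=> bal A B.
have DD n m f : iter n S' (iter n S (iter m S' (iter m S f))) =
                iter m S' (iter m S (iter n S' (iter n S f))).
  by apply: l2_ext => v; rewrite !adj_shift_diag mulrCA.
have DP := diag_commute bal.
have PPle n k f : iter n S (iter n S' (iter (n + k) S (iter (n + k) S' f))) =
                iter (n + k) S (iter (n + k) S' (iter n S (iter n S' f))).
  rewrite iterD [in RHS]iterD [(n + k)%N]addnC !(iterD k n).
  by rewrite DP.
have PP n m f : iter n S (iter n S' (iter m S (iter m S' f))) =
                iter m S (iter m S' (iter n S (iter n S' f))).
  by have [/subnKC <-|/ltnW/subnKC <-] := leqP n m; rewrite PPle.
by move=> [n _ [->|->]] [m _ [->|->]]; apply/funext => f /=.
Qed.

(** Compare the matrix entries at [(u1, u2)] of D_1 P_(n + 1) and P_(n + 1) D_1: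
    they are [diag 1 u1] and [diag 1 u2] times the same nonzero number. *)
Lemma centered_balanced :
  (forall A B, centered_family S S' A -> centered_family S S' B -> A \o B = B \o A) ->
  forall (u1 u2 : V) n w,
  parn T n.+1 u1 = Some w -> parn T n.+1 u2 = Some w ->
  path_weight n.+1 u1 != 0 -> path_weight n.+1 u2 != 0 ->
  weighted_child_sum (fun=> 1) u1 = weighted_child_sum (fun=> 1) u2.
Proof.
move=> cen u1 u2 n w p1 p2 w1 w2.
have E : iter 1 S' (iter 1 S (iter n.+1 S (iter n.+1 S' (delta R u2)))) =
         iter n.+1 S (iter n.+1 S' (iter 1 S' (iter 1 S (delta R u2)))).
  have c1 : centered_family S S' (iter 1 S' \o iter 1 S) by exists 1%N => //; right.
  have cn : centered_family S S' (iter n.+1 S \o iter n.+1 S') by exists n.+1 => //; left.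
  exact: (congr1 (fun F => F (delta R u2)) (cen _ _ c1 cn)).
have adj_single (c : R[i]) (h : l2 R V) : (forall v, h v = c * delta R u2 v) ->
    iter n.+1 S' h w = c * (path_weight n.+1 u2)^*%C.
  move=> hE; rewrite adj_iterE -[RHS](csum_delta _ u2); apply: eq_csum => v.
  rewrite hE deltaE; case: (v =P u2) => [->|_].
    by rewrite p2 eqxx mulr1.
  by rewrite mulr0 mul0r; case: ifP.
move/(congr1 (fun f : l2 R V => f u1)): E.
rewrite adj_shift_diag !wshift_iterE p1 (adj_single 1); last by move=> v; rewrite mul1r.
rewrite (adj_single ((diag 1 u2)%:C)%C); last first.
  move=> v; rewrite adj_shift_diag deltaE.
  by case: eqP => [->//|_]; rewrite !mulr0.
have w12 : path_weight n.+1 u1 * (path_weight n.+1 u2)^*%C != 0.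
  by rewrite mulf_neq0// conjc_eq0.
by rewrite mul1r [RHS]mulrCA => /(mulIf w12)/(congr1 (@complex.Re R)).
Qed.

End Centered.

(** In the theorem the common ancestor is at a positive distance [n.+1]; at
    distance 0 the two vertices coincide.  The sums over children are finite, so
    nothing is lost in comparing their real values. *)
Lemma balancedP (R : realType) (V : choiceType) (T : directed_tree V)
    (lam : V -> R[i]) (lam_bounded : bounded_weights T lam) : balanced T lam <->
  (forall u1 u2 : V,
     (exists n : nat,
        (exists2 w : V, parn T n.+1 u1 = Some w & parn T n.+1 u2 = Some w) /\
        weight_prod T lam n u1 * weight_prod T lam n u2 != 0) ->
     sumsq (Chi T u1) lam = sumsq (Chi T u2) lam).
Proof.
split=> [bal u1 u2 [n [[w p1 p2]]]|H u1 u2 [|n] w p1 p2 w1 w2].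
- rewrite mulf_eq0 negb_or => /andP[w1 w2].
  have := bal u1 u2 n.+1 w p1 p2 w1 w2; rewrite !weighted_child_sum1 => e.
  rewrite -(fineK (sumsq_Chi_fin lam_bounded u1)) e.
  by rewrite fineK// sumsq_Chi_fin.
- by move: p1 p2 => [->] [->].
- rewrite !weighted_child_sum1 (H u1 u2)//; exists n; split; first by exists w.
  exact: mulf_neq0.
Qed.

Theorem proposition14 (R : realType) (V : choiceType)
    (V_countable : countable [set: V]) (T : directed_tree V)
    (lam : V -> R[i]) (lam_bounded : bounded_weights T lam) :
  centered (wshift lam_bounded) <->
  (forall u1 u2 : V,
     (exists n : nat,
        (exists2 w : V, parn T n.+1 u1 = Some w & parn T n.+1 u2 = Some w) /\
        weight_prod T lam n u1 * weight_prod T lam n u2 != 0) ->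
     sumsq (Chi T u1) lam = sumsq (Chi T u2) lam).
Proof.
rewrite -(balancedP lam_bounded); split=> [[S' SS' cen]|bal].
- move=> u1 u2 [|n] w; first by move=> [->] [->].
  exact: centered_balanced SS' cen _ _ _ _.
- exists (wshift_adj lam_bounded); first exact: wshift_adjP.
  exact: balanced_centered (wshift_adjP _) bal.
Qed.
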